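(* For every integer $n\ge1$, the Ehrhart polynomial $H_{1,n}$ has all its complex roots on the line $R=\{z\in\mathbb{C}:\operatorname{Re}(z)=-\tfrac12\}$, and $H_{1,n}$ $R$-interlaces $H_{1,n+1}$.
   Context: For a finite simple undirected graph $G=(V,E)$, let $\mathbb{Z}^{|V|}$ be the lattice with basis $(e_v)_{v\in V}$. The symmetric edge polytope $P_G\subset\mathbb{R}^{|V|}$ is the convex hull of all vectors $e_{v_1}-e_{v_2}$ with $\{v_1,v_2\}\in E$ (both orders). The Ehrhart polynomial $H_G$ is the polynomial with $H_G(s)=|sP_G\cap\mathbb{Z}^{|V|}|$ for all integers $s\ge 0$. For the complete bipartite graph $K_{a,b}$ with parts of sizes $a$ and $b$, write $H_{a,b}=H_{K_{a,b}}$. Interlacing: let $L=\alpha+\mathbb{R}\beta$ be a line in $\mathbb{C}$ ($\alpha,\beta\in\mathbb{C}$, $\beta\ne0$), and let $f,g\in\mathbb{C}[x]$ with $m=\deg f=\deg g+1$ have all their zeros on $L$. Let $\alpha+t_1\beta,\dots,\alpha+t_m\beta$ and $\alpha+s_1\beta,\dots,\alpha+s_{m-1}\beta$ ($t_i,s_j\in\mathbb{R}$) be the zeros of $f$ and $g$, listed with multiplicity. Then $f$ is $L$-interlaced by $g$ (equivalently, $g$ $L$-interlaces $f$) if, after relabeling, $t_1\le s_1\le t_2\le\cdots\le t_{m-1}\le s_{m-1}\le t_m$. *)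

(* Defs.v *)
From mathcomp Require Import all_boot all_order all_algebra.
From mathcomp Require Import complex.
From mathcomp Require Import boolp classical_sets functions cardinality reals convex.

Set Implicit Arguments.
Unset Strict Implicit.
Unset Printing Implicit Defensive.

Import Order.TTheory GRing.Theory Num.Theory.

Local Open Scope classical_set_scope.
Local Open Scope ring_scope.
Local Open Scope complex_scope.
Local Open Scope card_scope.

Record sgraph (V : finType) := SGraph {
  adj :> rel V;
  adj_sym : symmetric adj;
  adj_irr : irreflexive adj }.

Section CompleteBipartite.
Variables a b : nat.

Definition bipartite_adj : rel ('I_a + 'I_b)%type := fun u v =>
  match u, v with
  | inl _, inr _ | inr _, inl _ => true
  | _, _ => false
  end.

Lemma bipartite_adj_sym : symmetric bipartite_adj.
Proof. by case=> u [] v. Qed.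

Lemma bipartite_adj_irr : irreflexive bipartite_adj.
Proof. by case. Qed.

Definition complete_bipartite : sgraph ('I_a + 'I_b)%type :=
  SGraph bipartite_adj_sym bipartite_adj_irr.

End CompleteBipartite.

Section Ehrhart.
Variables (R : realType) (V : finType).

(* [R^o] is [R] as a module over itself, which makes this the R-module R^V. *)
Local Notation vspaceR := {ffun V -> R^o}.

Definition basis_vec (v : V) : vspaceR := [ffun w => (w == v)%:R].

Definition convex_hull (A : set vspaceR) : set vspaceR :=
  smallest (@convex_set R vspaceR) A.

Definition edge_polytope (G : sgraph V) : set vspaceR :=
  convex_hull [set x | exists u v, adj G u v /\ x = basis_vec u - basis_vec v].

Definition lattice : set vspaceR := [set x | forall v, x v \is a Num.int].

Definition dilate (s : R) (P : set vspaceR) : set vspaceR :=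
  [set s *: x | x in P].

(* The number of lattice points is stated through an explicit [N] with
   [_ #= `I_N], so that finiteness of the set is part of the condition. *)
Definition is_ehrhart (G : sgraph V) (p : {poly R[i]}) : Prop :=
  forall s : nat, exists N : nat,
    (dilate s%:R (edge_polytope G) `&` lattice) #= `I_N /\ p.[s%:R] = N%:R.

(* A polynomial satisfying [is_ehrhart] is unique, being determined by its
   values at the natural numbers; the default value 0 would only be used if
   none existed. *)
Definition ehrhart (G : sgraph V) : {poly R[i]} := xget 0 (is_ehrhart G).

End Ehrhart.

Arguments ehrhart R {V} G.

Definition ehrhart_bipartite (R : realType) (a b : nat) : {poly R[i]} :=
  ehrhart R (complete_bipartite a b).

Section Interlacing.
Variable R : realType.
Implicit Types (f g : {poly R[i]}) (alpha beta : R[i]) (L : set R[i]).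

Definition line alpha beta : set R[i] := [set alpha + t%:C * beta | t in setT].

(* [ts] lists, with multiplicity, the parameters of all the zeros of [f]
   along alpha + R beta; in particular all the zeros of [f] are on that line. *)
Definition zeros_param alpha beta f (ts : seq R) : Prop :=
  f != 0 /\
  f = lead_coef f *: \prod_(t <- ts) ('X - (alpha + t%:C * beta)%:P).

(* [interlaces L g f]: f is L-interlaced by g.  The inequalities
   t_i <= s_i <= t_{i+1} force [ts] and [ss] to be sorted.  The choice of
   (alpha, beta) is immaterial: another one changes the parameters by an
   affine bijection of R, at worst reversing both lists. *)
Definition interlaces L g f : Prop :=
  exists alpha beta, [/\ beta != 0, L = line alpha beta &
    exists ts ss : seq R,
      [/\ zeros_param alpha beta f ts, zeros_param alpha beta g ss,
          size ts = (size ss).+1 &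
          forall i, (i < size ss)%N -> ts`_i <= ss`_i /\ ss`_i <= ts`_i.+1]].

Definition critical_line : set R[i] := [set z | complex.Re z = - 2^-1 :> R].

End Interlacing.

Arguments critical_line R : clear implicits.

(* Main.v *)
Require Import Defs.
From mathcomp Require Import all_boot all_order all_algebra.
From mathcomp Require Import complex polyrcf.
From mathcomp Require Import boolp classical_sets functions cardinality reals.
From mathcomp Require Import interval_inference convex.
From mathcomp Require Import ring lra zify.

Set Implicit Arguments.
Unset Strict Implicit.
Unset Printing Implicit Defensive.

Import Order.TTheory GRing.Theory Num.Theory.

Local Open Scope classical_set_scope.
Local Open Scope ring_scope.
Local Open Scope complex_scope.

(** The edges of the star [K_{1,n}] are linearly independent, so its polytope is
    a unimodular copy of the cross-polytope: [H_{1,n}(s)] counts the integer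
    points of [Z^n] of l1-norm at most [s].  These are the Delannoy numbers, which
    satisfy [(n+2) H_{n+2} = (2x+1) H_{n+1} + (n+1) H_n].  Writing
    [x = -1/2 + i t] and [H_n(x) = i^n q_n(t)] gives the real recurrence
    [(n+2) q_{n+2} = 2 t q_{n+1} - (n+1) q_n] of a family of orthogonal
    (Meixner-Pollaczek) polynomials, whose zeros are real and interlace. *)

(** * Delannoy numbers and their three-term recurrence *)

(* The number of points of Z^n of l1-norm at most s, counted by the first
   coordinate: either it is 0, or it is one of the two values +-(s - k) and
   leaves norm at most k for the other coordinates. *)
Fixpoint delannoy (n s : nat) : nat :=
  if n is m.+1 then (delannoy m s + 2 * \sum_(k < s) delannoy m k)%N else 1%N.

Lemma delannoyn0 n : delannoy n 0 = 1%N.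
Proof. by elim: n => //= n ->; rewrite big_ord0. Qed.

Lemma delannoySS n s : delannoy n.+1 s.+1 =
  (delannoy n.+1 s + delannoy n s.+1 + delannoy n s)%N.
Proof. by rewrite /= big_ord_recr /=; lia. Qed.

Lemma delannoy1n s : delannoy 1 s = (2 * s + 1)%N.
Proof. by rewrite /= sum_nat_const card_ord; lia. Qed.

(** Induction on [n], then on [s]: the Pascal-type rule [delannoySS] in three consecutive dimensions
    reduces the case [s.+1] to the case [s] and to the lower recurrence at [s] and [s.+1]. *)
Lemma delannoy_rec n s :
  (n.+2 * delannoy n.+2 s =
   (2 * s + 1) * delannoy n.+1 s + n.+1 * delannoy n s)%N.
Proof.
elim: n s => [|n IHn] s.
  elim: s => [|s IHs]; first by rewrite !delannoyn0.
  rewrite delannoySS mulnDr mulnDr IHs !delannoy1n; rewrite -[delannoy 0 _]/1%N.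
  by rewrite -[delannoy 0 _]/1%N; nia.
elim: s => [|s IHs]; first by rewrite !delannoyn0; lia.
have := IHn s; have := IHn s.+1; move: IHs.
have := delannoySS n.+2 s; have := delannoySS n.+1 s; have := delannoySS n s.
move: (delannoy n.+3 s.+1) (delannoy n.+3 s) (delannoy n.+2 s.+1)
 (delannoy n.+2 s) (delannoy n.+1 s.+1) (delannoy n.+1 s)
 (delannoy n s.+1) (delannoy n s) => a b c d e f g h.
nia.
Qed.

(** * Enumeration of the integer points of an l1-ball *)

Fixpoint int_ball (s : nat) : seq int :=
  if s is r.+1 then [:: r.+1%:Z, - r.+1%:Z & int_ball r] else [:: 0].

Lemma mem_int_ball s (x : int) : (x \in int_ball s) = (`|x| <= s)%N.
Proof. by elim: s => [|s IHs] /=; rewrite !inE ?IHs; lia. Qed.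

Lemma int_ball_uniq s : uniq (int_ball s).
Proof. by elim: s => //= s ->; rewrite !inE !mem_int_ball; lia. Qed.

Lemma sum_int_ball s (F : nat -> nat) :
  (\sum_(x <- int_ball s) F `|x| = F 0 + 2 * \sum_(k < s) F k.+1)%N.
Proof.
elim: s => [|s IHs] /=; first by rewrite big_seq1 big_ord0 muln0 addn0.
by rewrite !big_cons IHs big_ord_recr /=; lia.
Qed.

(** Peeling off the first coordinate makes the length of this list obey the recursion of
    [delannoy]. *)
Fixpoint l1_ball (n s : nat) : seq (seq int) :=
  if n is m.+1 then [seq x :: v | x <- int_ball s, v <- l1_ball m (s - `|x|)]
  else [:: [::]].

Lemma size_l1_ball n s : size (l1_ball n s) = delannoy n s.
Proof.
elim: n s => //= n IHn s.
rewrite size_allpairs_dep sumnE big_map.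
under eq_bigr do rewrite IHn.
rewrite (sum_int_ball s (fun k => delannoy n (s - k))) subn0.
(* The list is summed by the norm of the first coordinate, [delannoy] by the norm left for the
   others; reversing the index matches them. *)
congr (_ + 2 * _)%N; rewrite (reindex_inj rev_ord_inj) /=.
by apply: eq_bigr => i _; congr delannoy; have := ltn_ord i; lia.
Qed.

Lemma l1_ball_uniq n s : uniq (l1_ball n s).
Proof.
elim: n s => //= n IHn s; apply: allpairs_uniq_dep => //.
- exact: int_ball_uniq.
- by move=> [x v] [y w] _ _ /= [-> ->].
Qed.

Lemma mem_l1_ball n s v :
  (v \in l1_ball n s) = (size v == n) && (\sum_(x <- v) `|x| <= s)%N.
Proof.
elim: n s v => [|n IHn] s v /=.
  by case: v => [|x v]; rewrite inE ?big_nil.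
apply/allpairsPdep/idP => [[x [w [xs ws ->]]]|].
  move: ws xs; rewrite IHn mem_int_ball big_cons /= eqSS => /andP[-> /=].
  lia.
case: v => // x v; rewrite /= eqSS big_cons => /andP[sv le].
exists x, v; rewrite IHn mem_int_ball sv; split=> //=; lia.
Qed.

(** * Real polynomials with strictly interlacing zeros *)

Lemma lead_coef_gt0_neq0 (R : numDomainType) (p : {poly R}) :
  0 < lead_coef p -> p != 0.
Proof. by move=> lp; rewrite -lead_coef_eq0 gt_eqF. Qed.

Section RealInterlacing.
Variable R : rcfType.

(** Each root to the right of [x] contributes exactly one negative factor. *)
Lemma sign_prod_XsubC (l1 l2 : seq R) (x : R) :
  (forall y, y \in l1 -> y < x) -> (forall y, y \in l2 -> x < y) ->
  0 < (-1) ^+ size l2 * (\prod_(y <- l1 ++ l2) ('X - y%:P)).[x].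
Proof.
move=> l1x l2x; rewrite big_cat hornerM mulrCA mulr_gt0 //.
  rewrite horner_prod big_seq prodr_gt0 // => y /l1x yx.
  by rewrite !hornerE subr_gt0.
elim: l2 l2x => [|y l IHl] lx /=; first by rewrite big_nil !hornerE.
rewrite big_cons hornerM hornerXsubC exprS mulrACA mulr_gt0 //.
  by rewrite mulN1r opprB subr_gt0 lx ?mem_head.
by apply: IHl => z zl; rewrite lx // inE zl orbT.
Qed.

(** Strict, unlike [interlaces]: the induction needs nonzero values, hence genuine sign changes, at
    the points of [ts]. *)
Definition interlaced (ts ss : seq R) := size ts = (size ss).+1 /\
  forall i, (i < size ss)%N -> ts`_i < ss`_i < ts`_i.+1.

Lemma interlaced_sorted ts ss : interlaced ts ss -> sorted <%R ts.
Proof.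
move=> [sz H]; apply/(sortedP 0) => i; rewrite sz ltnS => /H /andP[].
exact: lt_trans.
Qed.

Lemma sorted_nth_lt (ts : seq R) i j : sorted <%R ts ->
  (i < j < size ts)%N -> ts`_i < ts`_j.
Proof.
move=> srt /andP[ij js].
by apply: (sorted_ltn_nth lt_trans) => //; rewrite inE ?(ltn_trans ij).
Qed.

(** Exactly the entries of [ss] from index [i] on lie to the right of [ts_i]. *)
Lemma interlaced_sign ts ss i : interlaced ts ss -> (i < size ts)%N ->
  0 < (-1) ^+ (size ss - i) * (\prod_(s <- ss) ('X - s%:P)).[ts`_i].
Proof.
move=> its its_i; have srt := interlaced_sorted its.
have [sz H] := its.
have := @sign_prod_XsubC (take i ss) (drop i ss) ts`_i.
rewrite cat_take_drop size_drop; apply=> y.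
- case/(nthP 0) => j; rewrite size_take_min leq_min => /andP[ji js] <-.
  rewrite nth_take //; have /andP[_ lt] := H _ js.
  move: ji; rewrite leq_eqVlt => /predU1P[<- //|ji].
  by apply: (lt_trans lt); rewrite sorted_nth_lt // ji.
- case/(nthP 0) => j; rewrite size_drop ltn_subRL => js <-.
  rewrite nth_drop; have /andP[lt _] := H _ js.
  case: j js lt => [|j] js lt; first by rewrite addn0 in lt *.
  by apply: lt_trans lt; rewrite sorted_nth_lt // sz addnS !ltnS leq_addr
    ltnW // -addnS.
Qed.

Lemma ivt_chain (p : {poly R}) (xs : seq R) : sorted <%R xs ->
  (forall i, (i.+1 < size xs)%N -> p.[xs`_i] * p.[xs`_i.+1] < 0) ->
  exists2 us : seq R, size us = (size xs).-1 &
    forall i, (i < size us)%N -> xs`_i < us`_i < xs`_i.+1 /\ root p us`_i.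
Proof.
move=> srt sgn.
have ex i : (i.+1 < size xs)%N ->
    exists u, xs`_i < u < xs`_i.+1 /\ root p u.
  move=> ilt; have /ltW le : xs`_i < xs`_i.+1 by rewrite sorted_nth_lt ?ltnS ?leqnn.
  by have [u] := poly_ivtoo le (sgn i ilt); rewrite in_itv /= => ? ?; exists u.
(* Made total in [i], with the dummy value 0 out of range, so that [xchoose] yields a function on
   all indices. *)
have {}ex i : exists u, (i.+1 < size xs)%N ==> (xs`_i < u < xs`_i.+1) && root p u.
  case: (boolP (i.+1 < size xs)%N) => [/ex[u [h1 h2]]|_]; last by exists 0.
  by exists u; rewrite h1 h2.
exists (mkseq (fun i => xchoose (ex i)) (size xs).-1) => [|i].
  by rewrite size_mkseq.
rewrite size_mkseq => ilt; rewrite nth_mkseq //.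
by move: ilt (xchooseP (ex i)); rewrite ltn_predRL => ilt /implyP/(_ ilt)/andP[].
Qed.

Definition fully_split (p : {poly R}) (ts : seq R) :=
  p = lead_coef p *: \prod_(t <- ts) ('X - t%:P).

Definition interlaced_polys (p q : {poly R}) :=
  [/\ 0 < lead_coef p, 0 < lead_coef q &
  exists ts ss, [/\ fully_split p ts, fully_split q ss & interlaced ts ss]].

Lemma size_fully_split p ts : p != 0 -> fully_split p ts -> size p = (size ts).+1.
Proof.
move=> p0 ->; rewrite size_scale ?lead_coef_eq0 //.
by rewrite size_prod_XsubC.
Qed.

(* At a root t of p the new polynomial takes the value - c q(t), so interlacing
   of p and q makes it change sign between consecutive roots of p, and also
   beyond the extreme ones. *)
Lemma interlaced_step (p q : {poly R}) (a c : R) : 0 < a -> 0 < c ->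
  interlaced_polys p q -> interlaced_polys (a *: ('X * p) - c *: q) p.
Proof.
move=> a0 c0 [lp lq [ts [ss [sp sq its]]]].
set r := _ - _.
have pn0 : p != 0 by exact: lead_coef_gt0_neq0.
have qn0 : q != 0 by exact: lead_coef_gt0_neq0.
have szp := size_fully_split pn0 sp.
have szq := size_fully_split qn0 sq.
have [szts H] := its.
have srt := interlaced_sorted its.
have size1 : size (a *: ('X * p)) = (size ts).+2.
  by rewrite size_scale ?gt_eqF // mulrC size_mulX // szp.
have size2 : (size (- (c *: q)) < size (a *: ('X * p)))%N.
  by rewrite size_polyN size_scale ?gt_eqF // size1 szq szts; lia.
have szr : size r = (size ts).+2 by rewrite size_polyDl.
have lr : lead_coef r = a * lead_coef p.
  by rewrite lead_coefDl // lead_coefZ lead_coefM lead_coefX mul1r.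
have lr0 : 0 < lead_coef r by rewrite lr mulr_gt0.
split=> //.
have rts i : (i < size ts)%N -> 0 < (-1) ^+ (size ts - i) * r.[ts`_i].
  move=> ilt; have := interlaced_sign its ilt.
  have -> : r.[ts`_i] = - c * lead_coef q * (\prod_(s <- ss) ('X - s%:P)).[ts`_i].
    rewrite hornerD hornerN !hornerZ hornerM; have -> : p.[ts`_i] = 0.
      apply/eqP; rewrite sp -/(root _ _) rootZ ?gt_eqF // root_prod_XsubC.
      by rewrite mem_nth.
    by rewrite {1}sq hornerZ; ring.
  (* The one extra factor [-1] cancels the sign of [- c]. *)
  have -> : (size ts - i = (size ss - i).+1)%N by lia.
  rewrite exprS; set A := _ ^+ _; set B := _.[_] => AB.
  have -> : -1 * A * (- c * lead_coef q * B) = c * lead_coef q * (A * B) by ring.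
  by apply: mulr_gt0 => //; apply: mulr_gt0.
pose m := size ts.
have [hi hiP] : exists2 x, ts`_m.-1 < x & 0 < r.[x].
  have [x0 Hx] := poly_pinfty_gt_lc lr0.
  exists (Num.max x0 (ts`_m.-1 + 1)).
    by rewrite lt_max ltrDl ltr01 orbT.
  by apply: (lt_le_trans lr0); apply: Hx; rewrite le_max lexx.
(* [r] has degree [m + 1], whence its sign near minus infinity; the reflection [r \Po - 'X] reduces
   this to the behaviour at plus infinity. *)
have [lo loP] : exists2 x, x < ts`_0 & 0 < (-1) ^+ m.+1 * r.[x].
  have lc' : lead_coef ((-1) ^+ m.+1 *: (r \Po - 'X)) = lead_coef r.
    rewrite lead_coefZ lead_coef_comp ?size_polyN ?size_polyX //.
    rewrite lead_coefN lead_coefX szr /= mulrCA.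
    by rewrite -expr2 sqrr_sign mulr1.
  have lr0' : 0 < lead_coef ((-1) ^+ m.+1 *: (r \Po - 'X)) by rewrite lc'.
  have [x0 Hx] := poly_pinfty_gt_lc lr0'.
  exists (- Num.max x0 (1 - ts`_0)).
    by rewrite ltrNl lt_max ltrBrDr addNr ltr01 orbT.
  apply: (lt_le_trans lr0').
  have -> y : (-1) ^+ m.+1 * r.[- y] = ((-1) ^+ m.+1 *: (r \Po - 'X)).[y].
    by rewrite !hornerE horner_comp !hornerE.
  by apply: Hx; rewrite le_max lexx.
move=> lo0 hi0.
(* The signs of [r] alternate along these [m + 2] points, which gives [m + 1] roots separated by
   [ts]. *)
pose xs := lo :: rcons ts hi.
have szxs : size xs = m.+2 by rewrite /= size_rcons.
have xs_mid i : (i < m)%N -> xs`_i.+1 = ts`_i.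
  by move=> im; rewrite /= nth_rcons im.
have xs_last : xs`_m.+1 = hi by rewrite /= nth_rcons ltnn eqxx.
have m0 : (0 < m)%N by rewrite /m szts.
have srtxs : sorted <%R xs.
  apply/(sortedP 0) => i; rewrite szxs !ltnS.
  case: i => [_|i im]; first by rewrite xs_mid.
  rewrite xs_mid //; case: (ltngtP i.+1 m) im => // [im _|im _].
    by rewrite xs_mid // sorted_nth_lt // ltnSn.
  by rewrite im xs_last; move: hiP; rewrite -im.
have sgxs i : (i < m.+2)%N -> 0 < (-1) ^+ (m.+1 - i) * r.[xs`_i].
  case: i => [_ //|i]; rewrite ltnS subSS ltnS leq_eqVlt.
  by case/predU1P=> [->|im]; rewrite ?xs_last ?subnn ?mul1r // xs_mid // rts.
have [|us szus Hus] := @ivt_chain r xs srtxs.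
  move=> i; rewrite szxs => im.
  have := mulr_gt0 (sgxs i (ltnW im)) (sgxs _ im).
  have -> : (m.+1 - i = (m.+1 - i.+1).+1)%N by lia.
  rewrite exprS; set A := _ ^+ _; rewrite mulrACA -[-1 * A * A]mulrA -expr2.
  by rewrite sqrr_sign mulr1 mulN1r oppr_gt0.
have {}szus : size us = m.+1 by rewrite szus szxs.
have iut : interlaced us ts.
  split=> // i im; have [/andP[_]] := Hus i (ltac:(rewrite szus; exact: ltnW)).
  rewrite xs_mid // => -> _ /=.
  by have [/andP[]] := Hus i.+1 (ltac:(by rewrite szus)); rewrite xs_mid.
exists us, ts; split=> //.
(* The roots found are distinct and as many as the degree of [r], so they are all of its zeros. *)
apply: all_roots_prod_XsubC; first by rewrite szus.
  by apply/(all_nthP 0) => i /Hus[].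
by rewrite uniq_rootsE; apply: lt_sorted_uniq; apply: interlaced_sorted iut.
Qed.

End RealInterlacing.

(** * Identity of polynomials on the naturals, cardinality and convexity *)

Lemma poly_nat_inj (R : numDomainType) (p q : {poly R}) :
  (forall k : nat, p.[k%:R] = q.[k%:R]) -> p = q.
Proof.
move=> pq; apply/eqP; rewrite -subr_eq0; apply/eqP.
apply: (@roots_geq_poly_eq0 _ _ [seq k%:R | k <- iota 0 (size (p - q))]).
- by apply/allP => _ /mapP[k _ ->]; rewrite rootE !hornerE pq subrr.
- by rewrite map_inj_uniq ?iota_uniq //; apply: mulrIn; rewrite oner_eq0.
- by rewrite size_map size_iota.
Qed.

Lemma card_eq_seq (T : choiceType) (s : seq T) :
  uniq s -> ([set` s] #= `I_(size s))%card.
Proof.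
case: s => [|x0 s'] us; first by rewrite set_nil II0.
set s := x0 :: s' in us *.
have -> : [set` s] = nth x0 s @` `I_(size s).
  apply/seteqP; split=> [x /= /(nthP x0)[i ilt <-]|_ [i /= ilt <-]].
    by exists i.
  exact: mem_nth.
apply: inj_card_eq => i j; rewrite !inE /= => ilt jlt /eqP.
by rewrite nth_uniq // => /eqP.
Qed.

(** Trades interval-typed scalars for plain inequalities on [t]. *)
Lemma convex_setP (R : realType) (M : lmodType R) (A : set M) :
  convex_set A <->
  forall x y t, 0 <= t <= 1 -> A x -> A y -> A (t *: x + (1 - t) *: y).
Proof.
split=> [cA x y t t01 Ax Ay|cA x y t]; last first.
  by rewrite !inE => Ax Ay; apply: cA => //; apply/andP; split.
have /andP[t0 t1] := t01.
by have := cA x y (Itv01 t0 t1); rewrite !inE; apply.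
Qed.

Lemma edge_polytope_convex (R : realType) (V : finType) (G : sgraph V) :
  convex_set (edge_polytope (R := R) G).
Proof.
apply/convex_setP => x y t t01 Px Py A [cA gA].
by move/convex_setP: (cA); apply => //; [apply: Px|apply: Py].
Qed.

(** * The polytope of the star and its lattice points *)

Section Star.
Variables (R : realType) (n : nat).
Local Notation V := ('I_1 + 'I_n)%type.
Local Notation vspaceR := {ffun V -> R^o}.

Definition star_l1 (x : vspaceR) : R := \sum_j `|x (inr j)|.

Lemma star_l1_scale a x : star_l1 (a *: x) = `|a| * star_l1 x.
Proof.
rewrite /star_l1 mulr_sumr; apply: eq_bigr => j _.
by rewrite ffunE normrM.
Qed.

Lemma sum_leaves_scale a (x : vspaceR) :
  \sum_j (a *: x) (inr j) = a * \sum_j x (inr j).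
Proof. by rewrite mulr_sumr; apply: eq_bigr => j _; rewrite ffunE. Qed.

(** The cross-polytope of radius [s] in the leaf coordinates, lifted to the hyperplane where all
    coordinates sum to 0. *)
Definition star_ball (s : R) : set vspaceR :=
  [set x : vspaceR | x (inl ord0) = - \sum_j x (inr j) /\ star_l1 x <= s].

Lemma star_ball_convex s : convex_set (star_ball s).
Proof.
apply/convex_setP => x y t /andP[t0 t1] [x0 xs] [y0 ys]; split.
  rewrite !ffunE x0 y0.
  under [in RHS]eq_bigr => j _ do rewrite [_ (inr j)]ffunE.
  by rewrite big_split /= !sum_leaves_scale opprD !scalerN.
have {t1} u0 : 0 <= 1 - t by rewrite subr_ge0.
have -> : s = t * s + (1 - t) * s by ring.
apply: (@le_trans _ _ (t * star_l1 x + (1 - t) * star_l1 y)); last first.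
  by rewrite lerD // ler_wpM2l.
rewrite /star_l1 !mulr_sumr -big_split; apply: ler_sum => j _.
rewrite !ffunE; apply: (le_trans (ler_normD _ _)).
by rewrite !normrM (ger0_norm t0) (ger0_norm u0).
Qed.

Definition star_edge (j : 'I_n) : vspaceR :=
  basis_vec R (inr j) - basis_vec R (inl ord0).

Lemma star_edge_in (j : 'I_n) :
  edge_polytope (complete_bipartite 1 n) (star_edge j) /\
  edge_polytope (complete_bipartite 1 n) (- star_edge j).
Proof.
split; apply: sub_gen_smallest; first by exists (inr j), (inl ord0).
by exists (inl ord0), (inr j); rewrite opprB.
Qed.

Lemma star_edge_sum (x : vspaceR) : x (inl ord0) = - \sum_j x (inr j) ->
  x = \sum_j x (inr j) *: star_edge j.
Proof.
move=> x0; apply/ffunP => -[i|j]; rewrite sum_ffunE.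
  rewrite ord1 x0 -sumrN; apply: eq_bigr => k _; rewrite !ffunE /= sub0r.
  by rewrite scalerN; congr (- _); rewrite /GRing.scale /= mulr1.
rewrite (bigD1 j) //= big1 ?addr0 => [|k kj]; rewrite !ffunE /=.
  by rewrite eqxx subr0 /GRing.scale /= mulr1.
have -> : (inr j == inr k :> V) = false.
  by apply/eqP => -[/eqP]; rewrite eq_sym (negPf kj).
by rewrite subr0 scaler0.
Qed.

(** The ball of radius 1 is convex and contains both orientations of each edge. Conversely, a point
    of the ball combines signed edges with weights [|x_j|], and the slack up to [s] is absorbed by
    the point 0. *)
Lemma dilate_star_polytope (s : R) : (0 < n)%N -> 0 <= s ->
  dilate s (edge_polytope (complete_bipartite 1 n)) = star_ball s.
Proof.
move=> n0 s0; apply/seteqP; split=> [_ [y Py <-]|x [x0 xs]].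
  have [y0 y1] : star_ball 1 y.
    move: y Py; apply: smallest_sub; first exact: star_ball_convex.
    have E (j : 'I_n) : star_ball 1 (star_edge j) /\ star_ball 1 (- star_edge j).
      have S0 (F : 'I_n -> R) :
          F j = 1 -> (forall k, k != j -> F k = 0) -> \sum_k F k = 1.
        by move=> Fj Fk; rewrite (bigD1 j) //= Fj big1 ?addr0.
      have ev k : star_edge j (inr k) = (k == j)%:R.
        by rewrite !ffunE /= subr0.
      have e0 : star_edge j (inl ord0) = -1 by rewrite !ffunE /= sub0r.
      have l1 : star_l1 (star_edge j) = 1.
        by apply: S0 => [|k /negPf kj]; rewrite ev ?eqxx ?normr1 // kj normr0.
      have sm : \sum_k star_edge j (inr k) = 1 :> R.
        by apply: S0 => [|k /negPf kj]; rewrite ev ?eqxx // kj.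
      split; split.
      - by rewrite e0 sm.
      - by rewrite l1.
      - by rewrite ffunE e0; under eq_bigr do rewrite ffunE; rewrite sumrN sm.
      - by rewrite -l1 /star_l1; under eq_bigr do rewrite ffunE normrN.
    move=> _ [[i|j] [[i'|j'] [//= _ ->]]].
      by rewrite (ord1 i); have [_] := E j'; rewrite /star_edge opprB.
    by rewrite (ord1 i'); have [] := E j.
  split.
    by rewrite ffunE y0 sum_leaves_scale scalerN.
  by rewrite star_l1_scale (ger0_norm s0) -[leRHS]mulr1 ler_wpM2l.
set P := edge_polytope _.
have cP : forall x y t, 0 <= t <= 1 -> P x -> P y -> P (t *: x + (1 - t) *: y).
  by apply/convex_setP/edge_polytope_convex.
(* 0 is the midpoint of an edge vector and its negative, so at least one leaf is required. *)
have P0 : P 0.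
  have [Pp Pm] := star_edge_in (Ordinal n0).
  have := cP _ _ 2^-1 _ Pp Pm; rewrite scalerN.
  have -> : 1 - 2^-1 = 2^-1 :> R by field.
  by rewrite subrr; apply; lra.
(* Built one leaf at a time, normalising by the partial l1-norm. *)
have comb (l : seq 'I_n) : exists2 b, P b &
    \sum_(j <- l) x (inr j) *: star_edge j = (\sum_(j <- l) `|x (inr j)|) *: b.
  elim: l => [|j l [b Pb eb]]; first by exists 0; rewrite ?big_nil ?scale0r.
  rewrite !big_cons eb.
  have [c Pc ->] : exists2 c, P c & x (inr j) *: star_edge j = `|x (inr j)| *: c.
    have [Pp Pm] := star_edge_in j.
    case: (lerP 0 (x (inr j))) => xj.
      by exists (star_edge j); rewrite // ger0_norm.
    by exists (- star_edge j); rewrite // ltr0_norm // scaleNr scalerN opprK.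
  set u := `|_|; set v := \sum_(_ <- _) _.
  have u0 : 0 <= u by rewrite /u.
  have v0 : 0 <= v by apply: sumr_ge0.
  (* If the total weight is 0 there is nothing to normalise by, and 0 serves as the witness. *)
  have [uv|uv] := eqVneq (u + v) 0.
    exists 0 => //; rewrite uv scale0r.
    have [-> ->] : u = 0 /\ v = 0 by lra.
    by rewrite !scale0r addr0.
  exists (u / (u + v) *: c + (1 - u / (u + v)) *: b).
    apply: cP => //; have uv0 : 0 < u + v.
      by rewrite lt_neqAle eq_sym uv; apply: addr_ge0.
    by rewrite divr_ge0 ?(ltW uv0) //= ler_pdivrMr // mul1r lerDl.
  by rewrite scalerDr !scalerA; congr (_ *: _ + _ *: _); field.
have [b Pb xb] := comb (index_enum 'I_n).
have {xb} : x = star_l1 x *: b by rewrite -xb; apply: star_edge_sum.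
have [s00|sn0] := eqVneq s 0.
  have -> : star_l1 x = 0.
    by apply/eqP; rewrite eq_le -{1}s00 xs; apply: sumr_ge0.
  by rewrite scale0r => ->; exists 0; rewrite // s00 scale0r.
move=> xb; have sp : 0 < s by rewrite lt_def sn0.
(* [b] is shrunk towards 0 by a ratio at most 1, which stays in [P] by convexity. *)
exists (star_l1 x / s *: b).
  have := cP b 0 (star_l1 x / s) _ Pb P0; rewrite scaler0 addr0; apply.
  by rewrite divr_ge0 ?sumr_ge0 //= ler_pdivrMr // mul1r.
by rewrite scalerA mulrCA divff // mulr1 -xb.
Qed.

(* The coordinates of a point of the polytope sum to 0, so the one at the centre
   is determined by those at the leaves. *)
Definition star_coord (v : seq int) (w : V) : R^o :=
  match w with inl _ => - \sum_(x <- v) x%:~R | inr j => (v`_j)%:~R end.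

Definition star_point (v : seq int) : vspaceR := [ffun w => star_coord v w].

Lemma star_lattice_points (s : nat) :
  star_ball s%:R `&` @lattice R V = star_point @` [set` l1_ball n s].
Proof.
apply/seteqP; split => [x [[x0 xs] xZ]|_ [v /= + <-]].
  exists [seq Num.floor (x (inr j)) | j <- enum 'I_n].
    rewrite /= mem_l1_ball size_map size_enum_ord eqxx /=.
    rewrite big_map big_enum /= -(ler_nat R) natr_sum.
    apply: le_trans xs; apply: ler_sum => j _.
    by rewrite natr_absz -{2}(floorK (xZ (inr j))) intr_norm.
  apply/ffunP => -[i|j]; rewrite ffunE /=.
    rewrite ord1 x0 big_map big_enum /=; congr (- _).
    by apply: eq_bigr => j _; rewrite floorK.
  by rewrite (nth_map j) ?size_enum_ord ?ltn_ord // nth_ord_enum floorK.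
rewrite mem_l1_ball => /andP[/eqP sv vs].
have tosum (T : nmodType) (F : int -> T) :
    \sum_(j < n) F v`_j = \sum_(x <- v) F x.
  by rewrite (big_nth 0) big_mkord sv.
split; last first.
  by move=> [i|j]; rewrite ffunE ?rpredN ?rpred_sum // => *; rewrite intr_int.
split.
  rewrite !ffunE /= -(tosum R (fun x => x%:~R)); congr (- _).
  by apply: eq_bigr => j _; rewrite ffunE.
rewrite -(ler_nat R) natr_sum in vs; apply: le_trans vs.
rewrite -(tosum R (fun x : int => `|x|%N%:R)) /star_l1; apply: ler_sum => j _.
by rewrite ffunE natr_absz intr_norm.
Qed.

Lemma card_star_points (s : nat) :
  (star_ball s%:R `&` @lattice R V #= `I_(delannoy n s))%card.
Proof.
rewrite star_lattice_points -size_l1_ball.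
apply: (@card_eq_trans _ _ _ _ [set` l1_ball n s]).
  apply: inj_card_eq => v w; rewrite !inE /= !mem_l1_ball.
  move=> /andP[/eqP sv _] /andP[/eqP sw _] /ffunP vw.
  apply: (@eq_from_nth _ 0); first by rewrite sw.
  move=> i; rewrite sv => ilt; have := vw (inr (Ordinal ilt)).
  by rewrite !ffunE /= => /intr_inj.
exact: card_eq_seq (l1_ball_uniq n s).
Qed.

(** [ehrhart] is obtained by choice, so [p] is compared with the chosen polynomial: both count the
    same finite sets, hence agree at all naturals. *)
Lemma ehrhart_star (p : {poly R[i]}) : (0 < n)%N ->
  (forall s : nat, p.[s%:R] = (delannoy n s)%:R) ->
  ehrhart_bipartite R 1 n = p.
Proof.
move=> n0 ps; have ep : is_ehrhart (complete_bipartite 1 n) p.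
  move=> s; exists (delannoy n s); split=> //.
  by rewrite dilate_star_polytope //; exact: card_star_points.
rewrite /ehrhart_bipartite /ehrhart.
case: xgetP => [q _ eq|/(_ p)//].
apply: poly_nat_inj => s; rewrite ps.
have [N [cN ->]] := eq s; congr (_%:R).
apply/card_eq_II.
apply: card_eq_trans (card_star_points s).
by rewrite card_eq_sym -dilate_star_polytope.
Qed.

End Star.

(** * Meixner-Pollaczek polynomials and transfer to the critical line *)

Section StarPolynomial.
Variable R : realType.
Local Notation C := R[i].

(** The [q_n] of the overview; the initial value [2 *: 'X] reflects [H_1 = 2x + 1 = 2 i t]. *)
Fixpoint meixner (n : nat) : {poly R} :=
  if n is m.+1 then
    if m is k.+1 then
      (2 / k.+2%:R) *: ('X * meixner m) - (k.+1%:R / k.+2%:R) *: meixner k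
    else 2 *: 'X
  else 1.

Lemma meixnerSS n : meixner n.+2 =
  (2 / n.+2%:R) *: ('X * meixner n.+1) - (n.+1%:R / n.+2%:R) *: meixner n.
Proof. by []. Qed.

Lemma meixner_interlaced n : interlaced_polys (meixner n.+1) (meixner n).
Proof.
elim: n => [|n IHn]; last first.
  by rewrite meixnerSS; apply: interlaced_step; rewrite ?divr_gt0 ?ltr0n.
split; rewrite /= ?lead_coefZ ?lead_coefX ?mulr1 ?lead_coef1 ?ltr0n //.
exists [:: 0], [::]; split=> //.
  by rewrite /fully_split big_seq1 subr0 lead_coefZ lead_coefX mulr1.
by rewrite /fully_split big_nil lead_coef1 scale1r.
Qed.

(* The argument - i (x + 1/2) is t when x = -1/2 + i t. *)
Definition star_poly (n : nat) : {poly C} :=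
  'i ^+ n *: (map_poly (real_complex R) (meixner n) \Po (- 'i *: ('X + 2^-1%:P))).

Lemma star_polyE n (z : C) : (star_poly n).[z] =
  'i ^+ n * (map_poly (real_complex R) (meixner n)).[- 'i * (z + 2^-1)].
Proof. by rewrite hornerZ horner_comp !hornerE. Qed.

Lemma star_poly_rec n (z : C) :
  n.+2%:R * (star_poly n.+2).[z] =
  (2 * z + 1) * (star_poly n.+1).[z] + n.+1%:R * (star_poly n).[z].
Proof.
rewrite !star_polyE meixnerSS; move: (meixner n.+1) (meixner n) => p q.
rewrite rmorphB /= !map_polyZ (rmorphM (map_poly (real_complex R))) /= map_polyX.
rewrite hornerD hornerN !hornerZ hornerM hornerX.
set a := _.[_]; set b := _.[_].
rewrite !rmorphM !fmorphV !rmorph_nat !exprS.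
have i2 : 'i * 'i = -1 :> C by rewrite -expr2 sqr_i.
have n0 : n.+2%:R != 0 :> C by rewrite pnatr_eq0.
(* A factor ['i * 'i] is isolated in each term; its value [-1] turns the minus of the real
   recurrence into a plus. *)
have -> : n.+2%:R * ('i * ('i * 'i ^+ n) * (2 / n.+2%:R * (- 'i * (z + 2^-1) * a)
   - n.+1%:R / n.+2%:R * b)) =
   - ('i * 'i) * ('i * 'i ^+ n) * (2 * (z + 2^-1)) * a
   - ('i * 'i) * 'i ^+ n * n.+1%:R * b :> C.
  by field; rewrite -natrD.
by rewrite i2; field.
Qed.

Lemma star_poly_delannoy n s : (star_poly n).[s%:R] = (delannoy n s)%:R.
Proof.
(* The recurrence has order two, so two consecutive indices are carried through the induction. *)
have [//] : (star_poly n).[s%:R] = (delannoy n s)%:R /\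
  (star_poly n.+1).[s%:R] = (delannoy n.+1 s)%:R.
elim: n => [|n [IH0 IH1]].
  split.
    by rewrite star_polyE rmorph1 hornerC mulr1.
  rewrite star_polyE /= map_polyZ map_polyX hornerZ hornerX rmorph_nat.
  rewrite -/(delannoy 1 s) delannoy1n natrD natrM.
  have i2 : 'i * 'i = -1 :> C by rewrite -expr2 sqr_i.
  have -> : 'i ^+ 1 * (2 * (- 'i * (s%:R + 2^-1))) =
    - ('i * 'i) * (2 * s%:R + 1) :> C by field.
  by rewrite i2 opprK mul1r.
split=> //; apply: (@mulfI _ n.+2%:R); first by rewrite pnatr_eq0.
rewrite star_poly_rec IH0 IH1 -[RHS]natrM (delannoy_rec n s).
by rewrite natrD natrM natrD !natrM.
Qed.

(** Substituting [- i (X + 1/2)] turns a factor [X - t] into [- i (X - (-1/2 + i t))], so the real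
    zeros become the parameters unchanged. *)
Lemma star_poly_split n ts : meixner n != 0 -> fully_split (meixner n) ts ->
  zeros_param (- 2^-1) 'i (star_poly n) ts.
Proof.
move=> q0 sq.
(* The scalar collects ['i ^+ n], the real leading coefficient and one [- 'i] per factor; as the
   product is monic, it is the leading coefficient. *)
have [c c0 E] : exists2 c, c != 0 &
   star_poly n = c *: \prod_(t <- ts) ('X - (- 2^-1 + t%:C * 'i)%:P).
  exists ('i ^+ n * ((lead_coef (meixner n))%:C * (- 'i) ^+ size ts)).
    rewrite !mulf_neq0 ?expf_neq0 ?oppr_eq0 ?neq0Ci //.
    by rewrite fmorph_eq0 lead_coef_eq0.
  rewrite /star_poly -!scalerA; congr (_ *: _).
  rewrite {1}sq map_polyZ comp_polyZ; congr (_ *: _).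
  rewrite rmorph_prod rmorph_prod /= -(big_map _ xpredT id).
  elim: ts {sq} => [|t ts IH]; first by rewrite /= !big_nil expr0 scale1r.
  rewrite /= !big_cons IH exprS -scalerA scalerAr scalerAl; congr (_ * _).
  rewrite rmorphB /= map_polyX map_polyC comp_polyB comp_polyX comp_polyC.
  have -> : (t%:C)%:P = (- 'i) *: (t%:C * 'i)%:P :> {poly C}.
    by rewrite -mul_polyC -polyCM mulrCA mulNr -expr2 sqr_i opprK mulr1.
  by rewrite -scalerBr polyCD polyCN opprD opprK addrA.
split.
  rewrite E scaler_eq0 negb_or c0 /=.
  by apply: monic_neq0; apply: monic_prod_XsubC.
have -> : lead_coef (star_poly n) = c; last by [].
by rewrite E lead_coefZ (monicP _) ?mulr1 //; apply: monic_prod_XsubC.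
Qed.

Lemma critical_lineE : critical_line R = line (- 2^-1) 'i.
Proof.
have half : - 2^-1 = (- 2^-1)%:C :> C by rewrite rmorphN fmorphV rmorph_nat.
rewrite /critical_line /line half.
apply/seteqP; split=> [[a b] /= ->|_ [t _ <-]] /=; last by ring.
exists b => //; apply/eqP; rewrite eq_complex /=.
by apply/andP; split; apply/eqP; ring.
Qed.

End StarPolynomial.

Theorem lemma4p6 (R : realType) (n : nat) (hn : (1 <= n)%N) :
  (forall z : R[i], root (ehrhart_bipartite R 1 n) z -> critical_line R z) /\
  interlaces (critical_line R)
    (ehrhart_bipartite R 1 n) (ehrhart_bipartite R 1 n.+1).
Proof.
have eE m : (0 < m)%N -> ehrhart_bipartite R 1 m = star_poly R m.
  by move=> m0; apply: ehrhart_star => // s; apply: star_poly_delannoy.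
rewrite !eE //.
have [l1 l0 [ts [ss [sp sq [sz its]]]]] := meixner_interlaced R n.
have zf := star_poly_split (lead_coef_gt0_neq0 l1) sp.
have zg := star_poly_split (lead_coef_gt0_neq0 l0) sq.
rewrite critical_lineE; split.
  case: zg => g0 -> z; rewrite rootZ ?lead_coef_eq0 //.
  rewrite -(big_map _ xpredT (fun c => 'X - c%:P)) root_prod_XsubC.
  by case/mapP=> t _ ->; exists t.
exists (- 2^-1), 'i; split; rewrite ?neq0Ci //.
by exists ts, ss; split=> // i /its /andP[/ltW ? /ltW ?].
Qed.
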